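(* Let $k$ be an infinite field, let $d\ge 4$ be an even integer, let $R=k[x_1,\ldots,x_d]_{(x_1,\ldots,x_d)}$, and let $I=(e_1,\ldots,e_d)\subset R$ be the edge ideal of the cycle of length $d$, where $e_i=x_ix_{i+1}$ for $1\le i<d$ and $e_d=x_1x_d$. Then $\mathrm{core}(I)$ is a finite intersection of minimal reductions of $I$.
   Context: A reduction of an ideal $I$ is an ideal $J\subset I$ with $I^{r+1}=JI^r$ for some integer $r\ge 0$; a minimal reduction is a reduction that is minimal with respect to inclusion among reductions of $I$. The core of $I$, $\mathrm{core}(I)$, is the intersection of all reductions of $I$; over a Noetherian local ring it equals the intersection of all minimal reductions. *)

(* Defs.v *)
From HB Require Import structures.
From mathcomp Require Import all_boot all_order all_algebra.
From mathcomp Require Import boolp classical_sets cardinality.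
From mathcomp Require Import mpoly.

Set Implicit Arguments.
Unset Strict Implicit.
Unset Printing Implicit Defensive.

Import GRing.Theory.

Local Open Scope ring_scope.
Local Open Scope classical_set_scope.

Section Ideals.
Variable A : comNzRingType.
Implicit Types (S I J K : set A).

(* Unlike [idealr_closed], the unit ideal is allowed. *)
Definition is_ideal I : Prop :=
  [/\ I 0, (forall x y, I x -> I y -> I (x + y))
    & (forall a x, I x -> I (a * x))].

Definition ideal_gen S : set A := smallest is_ideal S.

Definition ideal_mul I J : set A :=
  ideal_gen [set x * y | x in I & y in J].

Fixpoint ideal_exp I (r : nat) : set A :=
  if r is r'.+1 then ideal_mul I (ideal_exp I r') else [set: A].

Definition reduction I J : Prop :=
  [/\ is_ideal J, J `<=` I
    & exists r : nat, ideal_exp I r.+1 = ideal_mul J (ideal_exp I r)].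

Definition minimal_reduction I J : Prop :=
  reduction I J /\ (forall K, reduction I K -> K `<=` J -> K = J).

Definition core I : set A := \bigcap_(J in [set J | reduction I J]) J.

Lemma ideal_gen_ideal S : is_ideal (ideal_gen S).
Proof.
split=> [J [[]]//|x y Ix Iy J HJ|a x Ix J HJ]; have [[_ JD JM] _] := HJ.
  by apply: JD; [apply: Ix|apply: Iy].
by apply: JM; apply: Ix.
Qed.

Lemma sub_ideal_gen S : S `<=` ideal_gen S.
Proof. by move=> x Sx J [_]; apply. Qed.

Lemma ideal_gen_min S J : is_ideal J -> S `<=` J -> ideal_gen S `<=` J.
Proof. by move=> JI SJ x; apply. Qed.

End Ideals.

Section LocalRing.
Variables (k : fieldType) (n : nat).
Local Notation P := {mpoly k[n]}.
Local Notation "x %:F" := (tofrac x).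

Definition var_ideal : set P := ideal_gen (range (fun i : 'I_n => 'X_i : P)).

Lemma var_idealE (p : P) : var_ideal p <-> p@_0%MM = 0.
Proof.
have [I0 ID IM] := ideal_gen_ideal (range (fun i : 'I_n => 'X_i : P)).
split=> [|p0].
  apply: (@ideal_gen_min _ _ [set q : P | q@_0%MM = 0]); last first.
    by move=> _ [i _ <-] /=; rewrite mcoeffX mnm1_eq0.
  split=> [|x y /= x0 y0|a x /= x0]; first exact: mcoeff0.
    by rewrite mcoeffD x0 y0 addr0.
  by rewrite rmorphM /= x0 mulr0.
rewrite [p]mpolyE big_seq; apply: big_ind => //= m mp.
have [i mi] : exists i, m i != 0%N.
  apply/existsP; apply: contraT; rewrite negb_exists => /forallP m0.
  suff E : m = 0%MM by move: mp; rewrite E mcoeff_msupp p0 eqxx.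
  by apply/mnmP=> i; rewrite mnm0E; apply/eqP; have := m0 i; rewrite negbK.
have -> : m = ((m - U_(i)) + U_(i))%MM by rewrite submK // lep1mP.
rewrite mpolyXD scalerAl; apply: IM; apply: sub_ideal_gen; by exists i.
Qed.

(* The localization of k[x_1, .., x_n] at the prime ideal (x_1, .., x_n),
   realized inside the field of fractions of k[x_1, .., x_n]. *)
Definition loc_pred : {pred {fraction P}} :=
  fun z => `[< exists a s : P, ~ var_ideal s /\ z = a%:F / s%:F >].

Lemma loc_predP z :
  reflect (exists a s : P, ~ var_ideal s /\ z = a%:F / s%:F) (z \in loc_pred).
Proof. exact: asboolP. Qed.

Lemma var_idealNM (s t : P) :
  ~ var_ideal s -> ~ var_ideal t -> ~ var_ideal (s * t).
Proof.
move=> hs ht /var_idealE; rewrite rmorphM /= => /eqP; rewrite mulf_eq0.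
by case/orP=> /eqP /var_idealE.
Qed.

Lemma var_idealN_neq0 (s : P) : ~ var_ideal s -> s%:F != 0.
Proof.
move=> hs; rewrite tofrac_eq0; apply/eqP => s0; apply: hs; apply/var_idealE.
by rewrite s0 mcoeff0.
Qed.

Lemma var_idealN1 : ~ var_ideal 1.
Proof. by move/var_idealE; rewrite rmorph1 => /eqP; rewrite oner_eq0. Qed.

Lemma loc_pred_poly (p : P) : p%:F \in loc_pred.
Proof.
apply/loc_predP; exists p, 1; split; first exact: var_idealN1.
by rewrite rmorph1 divr1.
Qed.

Lemma loc_pred_subring : subring_closed loc_pred.
Proof.
split.
- by have := loc_pred_poly 1; rewrite rmorph1.
- move=> _ _ /loc_predP[a [s [hs ->]]] /loc_predP[b [t [ht ->]]].
  apply/loc_predP; exists (a * t - b * s), (s * t); split.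
    exact: var_idealNM.
  rewrite -[- (_ / _)]mulNr addf_div ?var_idealN_neq0//.
  by rewrite rmorphB !rmorphM /= mulNr.
- move=> _ _ /loc_predP[a [s [hs ->]]] /loc_predP[b [t [ht ->]]].
  apply/loc_predP; exists (a * b), (s * t); split; first exact: var_idealNM.
  by rewrite !rmorphM /= mulf_div.
Qed.

HB.instance Definition _ :=
  GRing.isSubringClosed.Build {fraction P} loc_pred loc_pred_subring.

Record loc_ring := LocRing {
  loc_val :> {fraction P};
  loc_valP : loc_val \in loc_pred }.

HB.instance Definition _ := [isSub for loc_val].
HB.instance Definition _ := [Choice of loc_ring by <:].
HB.instance Definition _ := [SubChoice_isSubComNzRing of loc_ring by <:].

Definition loc_poly (p : P) : loc_ring := LocRing (loc_pred_poly p).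

Lemma loc_poly_zmod : zmod_morphism loc_poly.
Proof. by move=> p q; apply: val_inj; rewrite /= rmorphB. Qed.

Lemma loc_poly_monoid : monoid_morphism loc_poly.
Proof.
by split=> [|p q]; apply: val_inj; rewrite /= ?rmorph1 ?rmorphM.
Qed.

HB.instance Definition _ :=
  GRing.isZmodMorphism.Build P loc_ring loc_poly loc_poly_zmod.
HB.instance Definition _ :=
  GRing.isMonoidMorphism.Build P loc_ring loc_poly loc_poly_monoid.

(* [ordS i] is i + 1 modulo n, so the last generator is x_n * x_1. *)
Definition cycle_edge (i : 'I_n) : loc_ring :=
  loc_poly ('X_i * 'X_(ordS i)).

Definition cycle_edge_ideal : set loc_ring := ideal_gen (range cycle_edge).

End LocalRing.

Arguments cycle_edge_ideal : clear implicits.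

(* Main.v *)
(* Write m for the maximal ideal of R and G(a) for the product of the odd
   coordinates of a in k^d minus the product of the even ones; G generates the
   kernel of k[T_1, .., T_d] -> k[x], T_i |-> e_i, so the special fiber ring of
   I is the hypersurface ring k[T]/(G).

   If K is a reduction of I, the image of K in I/mI = k^d generates an ideal
   of finite colength in k[T]/(G); hence it contains a hyperplane a^perp with
   G(a) != 0.  Restricting the linear syzygies
   x_(i+2) e_i = x_i e_(i+1) to a gives, modulo K + m^2 I, a cyclic system
   a_i x_(i+2) = a_(i+1) x_i with determinant G(a), so mI is contained in K by
   Nakayama.  Therefore the minimal reductions are exactly the ideals
   a^perp + mI with G(a) != 0, and core(I) = mI is the intersection of those
   attached to finitely many points a that span k^d. *)

Require Import Defs.
From HB Require Import structures.
From mathcomp Require Import all_boot all_order all_algebra.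
From mathcomp Require Import boolp classical_sets cardinality.
From mathcomp Require Import mpoly.
From mathcomp Require Import zify ring.
Import GRing.Theory.
Local Open Scope ring_scope.
Local Open Scope classical_set_scope.

Set Implicit Arguments.
Unset Strict Implicit.
Unset Printing Implicit Defensive.

(** * Parity on the cycle and fibres of the toric map on monomials *)

Section CyclicParity.
Variables (d : nat) (hd : (4 <= d)%N) (hev : ~~ odd d).

(** Parity also flips at the wrap-around: the last index d - 1 is odd because d is even, and its
    successor is 0. *)
Lemma odd_ordS (i : 'I_d) : odd (ordS i) = ~~ odd i.
Proof.
rewrite /=; have := ltn_ord i; rewrite leq_eqVlt => /orP[/eqP E|lt].
  by rewrite E modnn /=; move: (hev); rewrite -{1}E /= negbK => ->.
by rewrite modn_small //=.
Qed.

Lemma card_odd_even : #|[pred i : 'I_d | odd i]| = #|[pred i : 'I_d | ~~ odd i]|.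
Proof.
rewrite -(fintype.card_image (@ordS_inj d)); apply: eq_card => i.
rewrite -[i]ord_predK fintype.mem_image; last exact: ordS_inj.
by rewrite !inE odd_ordS negbK.
Qed.

(** As d >= 4, both [b] and [b + 2] are indices of parity [b], and at least one of them differs from
    [n]. *)
Lemma parity_other (b : bool) (n : nat) : exists2 i : 'I_d, odd i = b & i != n :> nat.
Proof.
have h4 := hd; case: (eqVneq n b) => [->|ne].
  have lt : (b.+2 < d)%N by case: b; lia.
  by exists (Ordinal lt); rewrite /= ?negbK //; case: b {lt}.
have lt : (b < d)%N by case: b {ne}; lia.
by exists (Ordinal lt); rewrite //=; [case: b {lt ne}|rewrite eq_sym].
Qed.

(** The polynomial G evaluated in an arbitrary ring: it is needed at points of k^d, along lines over
    k[X] and at constants lifted to R. *)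
Definition cycle_binomial (B : comNzRingType) (t : 'I_d -> B) : B :=
  \prod_(i < d | odd i) t i - \prod_(i < d | ~~ odd i) t i.

(** Exponent of the image of T^m in k[x]: x_i divides exactly the edges e_i and e_(i-1). *)
Definition edge_mnm (m : 'X_{1..d}) : 'X_{1..d} :=
  [multinom (m i + m (ord_pred i))%N | i < d].

(** Equal images fix each sum m_i + m_(i-1), so m - m' changes sign at every step and is determined
    by its value at 0. The inequality at [i0] makes the truncated subtraction exact. *)
Lemma edge_mnm_eq (m m' : 'X_{1..d}) (i0 : 'I_d) : i0 = 0%N :> nat ->
  edge_mnm m = edge_mnm m' -> (m i0 <= m' i0)%N ->
  forall i : 'I_d, if odd i then m i = (m' i + (m' i0 - m i0))%N
                   else m' i = (m i + (m' i0 - m i0))%N.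
Proof.
move=> i00 /mnmP Em le [n ltn]; elim: n => [|n IH] /= in ltn *.
  by rewrite (_ : Ordinal ltn = i0) ?subnKC //; apply: val_inj.
have ltn' : (n < d)%N by exact: ltnW.
have := Em (Ordinal ltn); rewrite !mnmE.
have -> : ord_pred (Ordinal ltn) = Ordinal ltn'.
  by apply: (@ordS_inj d); rewrite ord_predK; apply: val_inj; rewrite /= modn_small.
by have := IH ltn' => /=; case: (odd n) => /=; lia.
Qed.

(* Two monomials in the T_i with the same image in k[x] have exponents
   differing by an alternating vector. *)
Lemma toric_monomial (B : comNzRingType) (t : 'I_d -> B) (m m' : 'X_{1..d}) :
  edge_mnm m = edge_mnm m' ->
  exists q, mmap1 t m = mmap1 t m' + q * cycle_binomial t.
Proof.
have lt0 : (0 < d)%N by exact: leq_trans hd.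
pose i0 := Ordinal lt0.
wlog le : m m' / (m i0 <= m' i0)%N => [W|] E.
  case/orP: (leq_total (m i0) (m' i0)) => le; first exact: W.
  have [q ->] := W _ _ le (esym E); exists (- q).
  by rewrite mulNr addrK.
have D := edge_mnm_eq (erefl : val i0 = 0%N) E le.
set c := (m' i0 - m i0)%N in D.
(* [L] evaluates the greatest common divisor of the two monomials; the cofactors are [O ^+ c] and
   [N ^+ c], whose difference is a multiple of [O - N]. *)
pose L := (\prod_(i < d | odd i) t i ^+ m' i) * \prod_(i < d | ~~ odd i) t i ^+ m i.
pose O := \prod_(i < d | odd i) t i; pose N := \prod_(i < d | ~~ odd i) t i.
have e1 : mmap1 t m = L * O ^+ c.
  rewrite /mmap1 (bigID (fun i : 'I_d => odd i)) /= mulrAC -prodrXl -big_split /=.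
  congr (_ * _); apply: eq_bigr => i io.
  by have := D i; rewrite io => ->; rewrite exprD.
have e2 : mmap1 t m' = L * N ^+ c.
  rewrite /mmap1 (bigID (fun i : 'I_d => odd i)) /= -mulrA -prodrXl -big_split /=.
  congr (_ * _); apply: eq_bigr => i /negbTE io.
  by have := D i; rewrite io => ->; rewrite exprD.
exists (L * \sum_(i < c) O ^+ (c.-1 - i) * N ^+ i).
rewrite e1 e2 /cycle_binomial -/O -/N -mulrA [X in _ + L * X]mulrC.
have -> : (O - N) * (\sum_(i < c) O ^+ (c.-1 - i) * N ^+ i) = O ^+ c - N ^+ c.
  by rewrite subrXX; congr (_ * _); apply: eq_bigr => i _; rewrite subn1 -subnS.
by rewrite mulrBr addrC subrK.
Qed.

End CyclicParity.

(** * The kernel of the toric map *)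

Section EdgeSubstitution.
Variables (k : fieldType) (d : nat).
Local Notation P := {mpoly k[d]}.

Definition edge_poly (i : 'I_d) : P := 'X_i * 'X_(ordS i).

(** The cycle has as many edges as vertices, so [P] serves both as k[T] and as k[x]. *)
Definition edge_subst : P -> P := mmap (@mpolyC d k) edge_poly.

HB.instance Definition _ := GRing.RMorphism.copy edge_subst (mmap (@mpolyC d k) edge_poly).

Lemma edge_mnmX (m : 'X_{1..d}) : mmap1 edge_poly m = 'X_[edge_mnm m].
Proof.
rewrite mpolyXE_id /mmap1.
under eq_bigr do rewrite exprMn.
under [RHS]eq_bigr do rewrite mnmE exprD.
rewrite !big_split /=; congr (_ * _).
rewrite [RHS](reindex_inj (@ordS_inj d)); apply: eq_bigr => i _.
by rewrite ordSK.
Qed.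

Lemma mdeg_edge_mnm (m : 'X_{1..d}) : mdeg (edge_mnm m) = (2 * mdeg m)%N.
Proof.
rewrite !mdegE; under eq_bigr do rewrite mnmE.
rewrite big_split /= mul2n -addnn; congr (_ + _)%N.
rewrite (reindex_inj (@ordS_inj d)); apply: eq_bigr => i _.
by rewrite ordSK.
Qed.

Lemma edge_substE (h : P) :
  edge_subst h = \sum_(m <- msupp h) h@_m *: 'X_[edge_mnm m].
Proof.
by apply: eq_bigr => m _; rewrite edge_mnmX mul_mpolyC.
Qed.

Lemma edge_substX i : edge_subst 'X_i = edge_poly i.
Proof. by rewrite /edge_subst mmapX mmap1U. Qed.

Lemma edge_substZ c h : edge_subst (c *: h) = c *: edge_subst h.
Proof. by rewrite /edge_subst mmapZ /= mul_mpolyC. Qed.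

Lemma edge_subst_homog n (h : P) : h \is n.-homog -> edge_subst h \is (2 * n).-homog.
Proof.
move=> hh; rewrite edge_substE big_seq; apply: rpred_sum => m mh.
apply: rpredZ; rewrite dhomogX /= mdeg_edge_mnm.
by rewrite (dhomog_mf hh mh).
Qed.

(* The kernel of T_i |-> x_i x_(i+1) is generated by the cycle binomial. *)
Lemma edge_subst_ker (B : comNzRingType) (f : {rmorphism k -> B}) (t : 'I_d -> B)
    (h : P) : (4 <= d)%N -> ~~ odd d -> edge_subst h = 0 ->
  exists q, mmap f t h = q * cycle_binomial t.
Proof.
move=> hd hev h0.
(* [rep] chooses one monomial in each fibre of [edge_mnm]; modulo the binomial every monomial may be
   replaced by the representative of its fibre. Outside the image the value [n] is a dummy. *)
pose rep (n : 'X_{1..d}) :=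
  if pselect (exists m, edge_mnm m = n) is left H then projT1 (cid H) else n.
have rep_eq m : edge_mnm m = edge_mnm (rep (edge_mnm m)).
  rewrite /rep; case: pselect => [H|[]]; last by exists m.
  by rewrite (projT2 (cid H)).
pose q m := projT1 (cid (toric_monomial hd hev t (rep_eq m))).
have qE m : mmap1 t m = mmap1 t (rep (edge_mnm m)) + q m * cycle_binomial t.
  exact: (projT2 (cid (toric_monomial hd hev t (rep_eq m)))).
exists (\sum_(m <- msupp h) f h@_m * q m).
rewrite /mmap; under eq_bigr do rewrite qE mulrDr mulrA.
rewrite big_split /= -mulr_suml -[RHS]add0r; congr (_ + _).
pose S := undup [seq edge_mnm m | m <- msupp h].
have uS : uniq S by exact: undup_uniq.
transitivity (\sum_(m <- msupp h) \sum_(n <- S | n == edge_mnm m)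
                f h@_m * mmap1 t (rep n)).
  apply: eq_big_seq => m mh.
  rewrite (big_rem (edge_mnm m)) /=; last by rewrite mem_undup map_f.
  rewrite eqxx big_seq_cond big1 ?addr0 // => n.
  by rewrite mem_rem_uniq // inE => /andP[/andP[/negbTE ->]].
rewrite (exchange_big_dep predT) //= big1 // => n _.
rewrite -mulr_suml -rmorph_sum /=.
(* The coefficients of [h] along one fibre add up to a coefficient of [edge_subst h], which
   vanishes. *)
suff -> : \sum_(m <- msupp h | n == edge_mnm m) h@_m = 0 by rewrite rmorph0 mul0r.
transitivity ((edge_subst h)@_n); last by rewrite h0 mcoeff0.
rewrite edge_substE raddf_sum /= big_mkcond /=; apply: eq_bigr => m _.
by rewrite mcoeffZ mcoeffX eq_sym; case: eqP; rewrite ?mulr1 ?mulr0.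
Qed.

End EdgeSubstitution.

(** * Residues and orders in the local ring *)

Section LocalRingTheory.
Variables (k : fieldType) (d : nat).
Local Notation P := {mpoly k[d]}.
Local Notation R := (loc_ring k d).
Local Notation "x %:F" := (tofrac x).
Implicit Types (p q s : P) (f g : R).

Lemma loc_fracP f : exists a s : P, s@_0%MM != 0 /\ val f = a%:F / s%:F.
Proof.
have /loc_predP[a [s [hs E]]] := loc_valP f.
by exists a, s; split=> //; apply/eqP => s0; apply: hs; apply/var_idealE.
Qed.

Lemma const_neq0_frac s : s@_0%MM != 0 -> s%:F != 0.
Proof. by rewrite tofrac_eq0; apply: contraNneq => ->; rewrite mcoeff0. Qed.

(** The quotient map onto R/m = k, read off from a chosen fraction a/s as a(0)/s(0); [residueE]
    gives independence of the choice. *)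
Definition residue f : k :=
  let w := cid (loc_fracP f) in (projT1 w)@_0%MM / (projT1 (cid (projT2 w)))@_0%MM.

Lemma residueE f a s : s@_0%MM != 0 -> val f = a%:F / s%:F ->
  residue f = a@_0%MM / s@_0%MM.
Proof.
move=> s0 E; rewrite /residue; case: (cid _) => /= a' H; case: (cid _) => /= s' [s'0].
rewrite E => /eqP; rewrite eqr_div ?const_neq0_frac // -!rmorphM /= tofrac_eq => /eqP E'.
apply/eqP; rewrite eqr_div // -!rmorphM /=; apply/eqP.
by rewrite E' mulrC.
Qed.

Lemma residue_zmod : zmod_morphism residue.
Proof.
move=> f g; have [a [s [s0 Ef]]] := loc_fracP f; have [b [t [t0 Eg]]] := loc_fracP g.
rewrite (residueE s0 Ef) (residueE t0 Eg).
rewrite (@residueE _ (a * t - b * s) (s * t)).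
- by rewrite raddfB /= !rmorphM /= -[X in _ = _ + X]mulNr addf_div // mulNr.
- by rewrite rmorphM mulf_neq0.
- rewrite [LHS]rmorphB /= -[loc_val f]/(val f) -[loc_val g]/(val g) Ef Eg -[- (_ / _)]mulNr.
  by rewrite addf_div ?const_neq0_frac // rmorphB !rmorphM /= mulNr.
Qed.

Lemma residue_monoid : monoid_morphism residue.
Proof.
split=> [|f g].
  rewrite (@residueE _ 1 1) ?rmorph1 ?divr1 ?oner_eq0 //.
have [a [s [s0 Ef]]] := loc_fracP f; have [b [t [t0 Eg]]] := loc_fracP g.
rewrite (residueE s0 Ef) (residueE t0 Eg).
rewrite (@residueE _ (a * b) (s * t)).
- by rewrite !rmorphM /= mulf_div.
- by rewrite rmorphM mulf_neq0.
- by rewrite [LHS]rmorphM /= -[loc_val f]/(val f) -[loc_val g]/(val g) Ef Eg mulf_div !rmorphM.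
Qed.

HB.instance Definition _ := GRing.isZmodMorphism.Build R k residue residue_zmod.
HB.instance Definition _ := GRing.isMonoidMorphism.Build R k residue residue_monoid.

Lemma residue_poly p : residue (loc_poly p) = p@_0%MM.
Proof.
rewrite (@residueE _ p 1) ?rmorph1 ?divr1 ?oner_eq0 //.
Qed.

Definition loc_const (c : k) : R := loc_poly c%:MP.

HB.instance Definition _ := GRing.RMorphism.copy loc_const (@loc_poly k d \o @mpolyC d k).

Lemma residue_const c : residue (loc_const c) = c.
Proof. by rewrite residue_poly mcoeffC eqxx mulr1. Qed.

Lemma loc_inverse f : residue f != 0 -> exists g, g * f = 1.
Proof.
have [a [s [s0 Ef]]] := loc_fracP f; rewrite (residueE s0 Ef) => fn0.
have a0 : a@_0%MM != 0 by apply: contraNneq fn0 => ->; rewrite mul0r.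
have inv : s%:F / a%:F \in @loc_pred k d.
  apply/loc_predP; exists s, a; split => // /var_idealE ae; by rewrite ae eqxx in a0.
exists (LocRing inv); apply: val_inj; rewrite rmorphM rmorph1 /= -[loc_val f]/(val f) Ef.
by rewrite mulf_div [a%:F * _]mulrC divff // mulf_neq0 // const_neq0_frac.
Qed.

Definition poly_order_ge n p := forall m : 'X_{1..d}, (mdeg m < n)%N -> p@_m = 0.

Lemma poly_order_geM n n' p q :
  poly_order_ge n p -> poly_order_ge n' q -> poly_order_ge (n + n') (p * q).
Proof.
move=> hp hq m lt; apply/eqP; rewrite mcoeff_eq0; apply: contraL lt.
case/msuppM_le/allpairsP => -[m1 m2] /= [i1 i2 ->]; rewrite mdegD -leqNgt.
apply: leq_add; rewrite leqNgt; apply/negP => lt.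
  by move: i1; rewrite mcoeff_msupp hp ?eqxx.
by move: i2; rewrite mcoeff_msupp hq ?eqxx.
Qed.

Lemma poly_order_geD n p q :
  poly_order_ge n p -> poly_order_ge n q -> poly_order_ge n (p + q).
Proof. by move=> hp hq m lt; rewrite mcoeffD hp // hq // addr0. Qed.

Lemma homog_order_ge n p : p \is n.-homog -> poly_order_ge n p.
Proof. by move=> hp m lt; apply: (dhomog_nemf_coeff hp); rewrite /= ltn_eqF. Qed.

(** Membership in the n-th power of m, phrased by the low coefficients of a numerator so that it can
    be tested on polynomials. *)
Definition loc_order_ge n f :=
  exists a s : P, [/\ s@_0%MM != 0, val f = a%:F / s%:F & poly_order_ge n a].

Lemma loc_order_geM n n' f g :
  loc_order_ge n f -> loc_order_ge n' g -> loc_order_ge (n + n') (f * g).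
Proof.
move=> [a [s [s0 Ef ha]]] [b [t [t0 Eg hb]]]; exists (a * b), (s * t); split.
- by rewrite rmorphM mulf_neq0.
- by rewrite [LHS]rmorphM /= -[loc_val f]/(val f) -[loc_val g]/(val g) Ef Eg mulf_div !rmorphM.
- exact: poly_order_geM.
Qed.

Lemma loc_order_ge0 f : loc_order_ge 0 f.
Proof. by have [a [s [s0 Ef]]] := loc_fracP f; exists a, s; split. Qed.

Lemma loc_order_ge_ideal n : is_ideal (loc_order_ge n).
Proof.
split.
- exists 0, 1; split; rewrite ?rmorph1 ?oner_eq0 ?rmorph0 ?mul0r //.
  by move=> m _; rewrite mcoeff0.
- move=> f g [a [s [s0 Ef ha]]] [b [t [t0 Eg hb]]]; exists (a * t + b * s), (s * t).
  split.
  + by rewrite rmorphM mulf_neq0.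
  + rewrite [LHS]rmorphD /= -[loc_val f]/(val f) -[loc_val g]/(val g) Ef Eg.
    by rewrite addf_div ?const_neq0_frac // rmorphD !rmorphM.
  + by apply: poly_order_geD; rewrite -[n]addn0; apply: poly_order_geM => //.
- by move=> f g hg; rewrite -[n]add0n; apply: loc_order_geM => //; apply: loc_order_ge0.
Qed.

Lemma loc_order_poly n p : poly_order_ge n p -> loc_order_ge n (loc_poly p).
Proof.
by move=> hp; exists p, 1; split; rewrite ?rmorph1 ?divr1 ?oner_eq0.
Qed.

Lemma residue0_order_ge1 f : residue f = 0 -> loc_order_ge 1 f.
Proof.
have [a [s [s0 Ef]]] := loc_fracP f; rewrite (residueE s0 Ef) => /eqP.
rewrite mulf_eq0 invr_eq0 (negbTE s0) orbF => /eqP a0.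
exists a, s; split=> // m; rewrite ltnS leqn0 mdeg_eq0 => /eqP ->; exact: a0.
Qed.

(** If p = a/s, then p s = a has order above n, while its part of degree n is s(0) p with s(0)
    nonzero. *)
Lemma homog_order_gt_eq0 n p :
  p \is n.-homog -> loc_order_ge n.+1 (loc_poly p) -> p = 0.
Proof.
move=> hp [a [s [s0 E ha]]].
have {E} Ea : p * s = a.
  apply/eqP; rewrite -tofrac_eq rmorphM /= -[p%:F]/(val (loc_poly p)) E.
  by rewrite divfK // const_neq0_frac.
have hr : poly_order_ge 1 (s - (s@_0)%:MP).
  move=> m; rewrite ltnS leqn0 mdeg_eq0 => /eqP ->.
  by rewrite mcoeffB mcoeffC eqxx mulr1 subrr.
have := poly_order_geM (homog_order_ge hp) hr; rewrite addn1 mulrBr Ea => hps.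
apply/mpolyP => m; rewrite mcoeff0.
have [dm|dm] := eqVneq (mdeg m) n; last exact: (dhomog_nemf_coeff hp).
have lt : (mdeg m < n.+1)%N by rewrite dm.
have /eqP := hps m lt; rewrite mcoeffB ha // sub0r oppr_eq0.
by rewrite mulrC mcoeffCM mulf_eq0 (negbTE s0) /= => /eqP ->.
Qed.

(** * Nakayama's lemma *)

Section Nakayama.
Variables (T : finType) (y : T -> R) (K : set R).
Hypothesis KI : is_ideal K.

Lemma is_ideal_sum (I : Type) (r : seq I) (Q : pred I) (F : I -> R) :
  (forall i, Q i -> K (F i)) -> K (\sum_(i <- r | Q i) F i).
Proof. by case: KI => K0 KD _ H; apply: big_ind. Qed.

Lemma is_ideal_opp f : K f -> K (- f).
Proof. by case: KI => _ _ KM Kf; rewrite -mulN1r; apply: KM. Qed.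

Lemma is_ideal_sub f g : K f -> K g -> K (f - g).
Proof. by case: (KI) => _ KD _ Kf Kg; apply: KD => //; exact: is_ideal_opp. Qed.

Lemma is_ideal_cancel f g : residue f != 0 -> K (f * g) -> K g.
Proof.
case: KI => _ _ KM /loc_inverse[h hf] Kfg.
by rewrite -[g]mul1r -hf -mulrA; apply: KM.
Qed.

(** Determinant trick: [A = 1 - C] reduces to the identity matrix over k, so [\det A] is a unit, and
    the adjugate writes [\det A * y i] as a combination of elements of [K]. *)
Lemma nakayama :
  (forall i, exists2 c : T -> R, (forall j, residue (c j) = 0)
     & K (y i - \sum_j c j * y j)) ->
  forall i, K (y i).
Proof.
move=> H; pose c i := s2val (cid2 (H i)).
have c0 i j : residue (c i j) = 0 by rewrite /c; case: (cid2 _).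
have cK i : K (y i - \sum_j c i j * y j) by rewrite /c; case: (cid2 _).
pose n := #|T|; pose C := \matrix_(i < n, j < n) c (enum_val i) (enum_val j).
pose Y := \col_(i < n) y (enum_val i).
pose A := 1%:M - C.
have AY (i : 'I_n) : K ((A *m Y) i 0).
  rewrite mulmxBl mul1mx !mxE.
  suff -> : \sum_j C i j * Y j 0 = \sum_j c (enum_val i) j * y j by exact: cK.
  rewrite [RHS](reindex _ (onW_bij _ (@enum_val_bij T))) /=.
  by apply: eq_bigr => j _; rewrite !mxE.
have detA : residue (\det A) = 1.
  rewrite -det_map_mx map_mxB map_scalar_mx rmorph1 (_ : map_mx _ C = 0) ?subr0 ?det1 //.
  by apply/matrixP => i j; rewrite !mxE; exact: c0.
move=> i; rewrite -[i]enum_rankK; set j := enum_rank i.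
apply: (@is_ideal_cancel (\det A)); first by rewrite detA oner_eq0.
have -> : \det A * y (enum_val j) = (\adj A *m (A *m Y)) j 0.
  by rewrite mulmxA mul_adj_mx mul_scalar_mx !mxE.
rewrite mxE; apply: is_ideal_sum => l _; case: KI => _ _; apply; exact: AY.
Qed.

End Nakayama.
End LocalRingTheory.

(** * Products and powers of ideals given by generators *)

Section IdealProducts.
Variable A : comNzRingType.
Implicit Types I J L : set A.

Lemma ideal_mul_mem I J x y : I x -> J y -> ideal_mul I J (x * y).
Proof. by move=> Ix Jy; apply: sub_ideal_gen; exists x => //; exists y. Qed.

Lemma ideal_mul_sub I J L : is_ideal L ->
  (forall x y, I x -> J y -> L (x * y)) -> ideal_mul I J `<=` L.
Proof. by move=> LI H; apply: ideal_gen_min => // _ [x Ix [y Jy <-]]; apply: H. Qed.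

Lemma ideal_mul_ideal I J : is_ideal (ideal_mul I J).
Proof. exact: ideal_gen_ideal. Qed.

Variables (T : Type) (e : T -> A).
Local Notation I := (ideal_gen (range e)).

Lemma gen_mem i : I (e i).
Proof. by apply: sub_ideal_gen; exists i. Qed.

Lemma gen_power_mem (s : seq T) : ideal_exp I (size s) (\prod_(i <- s) e i).
Proof.
elim: s => [|i s IH]; first by rewrite big_nil.
by rewrite big_cons; apply: ideal_mul_mem => //; apply: gen_mem.
Qed.

(** Induction on [n] for all [L] at once: for a generator [e i] it is applied to the colon ideal of
    [L] by [e i]. *)
Lemma gen_power_sub n L : is_ideal L ->
  (forall s : seq T, size s = n -> L (\prod_(i <- s) e i)) -> ideal_exp I n `<=` L.
Proof.
elim: n L => [|n IH] L LI H.
  by move=> x _; rewrite -[x]mulr1; case: (LI) => _ _; apply; have := H [::]; rewrite big_nil; apply.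
have [L0 LD LM] := LI.
apply: ideal_mul_sub => // x y Ix Iy; move: x Ix.
apply: ideal_gen_min => [|_ [i _ <-]].
  split=> [|a b La Lb|a b Lb] /=; first by rewrite mul0r.
    by rewrite mulrDl; apply: LD.
  by rewrite -mulrA; apply: LM.
move: y Iy; apply: IH.
  split=> [|a b La Lb|a b Lb] /=; first by rewrite mulr0.
    by rewrite mulrDr; apply: LD.
  by rewrite mulrCA; apply: LM.
by move=> s sn /=; have := H (i :: s); rewrite big_cons; apply; rewrite /= sn.
Qed.

End IdealProducts.

Lemma gen_finP (A : comNzRingType) (T : finType) (e : T -> A) x :
  ideal_gen (range e) x <-> exists c : T -> A, x = \sum_i c i * e i.
Proof.
split=> [|[c ->]]; last first.
  have [I0 ID IM] := ideal_gen_ideal (range e).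
  by apply: big_ind => // i _; apply: IM; apply: gen_mem.
move: x; apply: ideal_gen_min => [|_ [i _ <-]].
  split=> [|_ _ [c ->] [c' ->]|a _ [c ->]].
  - by exists (fun=> 0); rewrite big1 // => i _; rewrite mul0r.
  - exists (fun i => c i + c' i); rewrite -big_split /=.
    by apply: eq_bigr => i _; rewrite mulrDl.
  - exists (fun i => a * c i); rewrite mulr_sumr.
    by apply: eq_bigr => i _; rewrite mulrA.
exists (fun j => (j == i)%:R).
rewrite (bigD1 i) //= eqxx mul1r big1 ?addr0 // => j /negbTE ->.
by rewrite mul0r.
Qed.

(** * Initial forms in the special fiber ring *)

Section Symbols.
Variables (k : fieldType) (d : nat).
Local Notation P := {mpoly k[d]}.
Local Notation R := (loc_ring k d).
Local Notation e := (@cycle_edge k d).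
Local Notation I := (cycle_edge_ideal k d).

(* [h] is the image of [f] in degree n of the special fiber ring. *)
Definition symbol n (f : R) (h : P) :=
  h \is n.-homog /\ loc_order_ge (2 * n).+1 (f - loc_poly (edge_subst h)).

Lemma loc_order_geW n (f : R) : loc_order_ge n.+1 f -> loc_order_ge n f.
Proof.
move=> [a [s [s0 E ha]]]; exists a, s; split=> // m lt; apply: ha; exact: ltnW.
Qed.

Lemma edge_subst_order n h : h \is n.-homog ->
  loc_order_ge (2 * n) (loc_poly (edge_subst h) : R).
Proof. by move=> hh; apply: loc_order_poly; apply: homog_order_ge; apply: edge_subst_homog. Qed.

Lemma symbol_order n f h : symbol n f h -> loc_order_ge (2 * n) f.
Proof.
move=> [hh hf]; rewrite -[f](subrK (loc_poly (edge_subst h))).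
have [_ D _] := loc_order_ge_ideal k d (2 * n); apply: D; first exact: loc_order_geW.
exact: edge_subst_order.
Qed.

Lemma symbolM n n' f f' h h' :
  symbol n f h -> symbol n' f' h' -> symbol (n + n') (f * f') (h * h').
Proof.
move=> S S'; have of_ := symbol_order S; move: S S' => [hh hf] [hh' hf'].
split; first exact: dhomogM.
rewrite !rmorphM /= -[X in _ - X]/(loc_poly (edge_subst h) * loc_poly (edge_subst h')).
set s := loc_poly (edge_subst h) in hf *; set s' := loc_poly (edge_subst h') in hf' *.
have -> : f * f' - s * s' = f * (f' - s') + (f - s) * s' by ring.
have [_ D _] := loc_order_ge_ideal k d (2 * (n + n')).+1; apply: D.
  by rewrite mulnDr -addnS; apply: loc_order_geM.
by rewrite mulnDr -addSn; apply: loc_order_geM => //; exact: edge_subst_order.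
Qed.

Lemma symbolD n f f' h h' : symbol n f h -> symbol n f' h' -> symbol n (f + f') (h + h').
Proof.
move=> [hh hf] [hh' hf']; split; first exact: dhomogD.
rewrite !rmorphD /= opprD addrACA.
by have [_ D _] := loc_order_ge_ideal k d (2 * n).+1; apply: D.
Qed.

Lemma symbol0 n : symbol n 0 0.
Proof.
split; first exact: dhomog0.
by rewrite !rmorph0 subr0; case: (loc_order_ge_ideal k d (2 * n).+1).
Qed.

(** [u] differs from its residue by an element of m, which raises the order, so R acts on initial
    forms through k. *)
Lemma symbolZ n u f h : symbol n f h -> symbol n (u * f) (residue u *: h).
Proof.
move=> [hh hf]; split; first exact: dhomogZ.
have -> : loc_poly (edge_subst (residue u *: h)) =
          loc_const d (residue u) * loc_poly (edge_subst h) :> R.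
  by rewrite edge_substZ -mul_mpolyC rmorphM.
set s := loc_poly _ in hf *; set c := loc_const _ _.
have -> : u * f - c * s = u * (f - s) + (u - c) * s by ring.
have [_ D M] := loc_order_ge_ideal k d (2 * n).+1; apply: D; first exact: M.
rewrite -add1n; apply: loc_order_geM; last exact: edge_subst_order.
by apply: residue0_order_ge1; rewrite rmorphB /= residue_const subrr.
Qed.

Lemma symbol_edge i : symbol 1 (e i) 'X_i.
Proof.
split; first by rewrite dhomogX /= mdeg1.
rewrite edge_substX subrr.
by case: (loc_order_ge_ideal k d (2 * 1).+1).
Qed.

Lemma symbol_sum n (T : Type) (r : seq T) (F : T -> R) (H : T -> P) :
  (forall i, symbol n (F i) (H i)) ->
  symbol n (\sum_(i <- r) F i) (\sum_(i <- r) H i).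
Proof.
move=> S; elim: r => [|i r IH]; first by rewrite !big_nil; apply: symbol0.
by rewrite !big_cons; apply: symbolD.
Qed.

Lemma symbol_linear (c : 'I_d -> R) :
  symbol 1 (\sum_i c i * e i) (\sum_i residue (c i) *: 'X_i).
Proof. by apply: symbol_sum => i; apply: symbolZ; apply: symbol_edge. Qed.

Lemma symbol1 : symbol 0 1 1.
Proof.
split; first exact: dhomog1.
by rewrite !rmorph1 subrr; case: (loc_order_ge_ideal k d (2 * 0).+1).
Qed.

Lemma symbolX n f h r : symbol n f h -> symbol (n * r) (f ^+ r) (h ^+ r).
Proof.
move=> S; elim: r => [|r IH]; last by rewrite mulnS !exprS; apply: symbolM.
by rewrite muln0 !expr0; apply: symbol1.
Qed.

(** The difference of the two images is homogeneous of degree 2n but has order above 2n. Symbols are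
    unique only up to this kernel. *)
Lemma symbol_eq n f h h' :
  symbol n f h -> symbol n f h' -> edge_subst (h - h') = 0.
Proof.
move=> [hh hf] [hh' hf']; have hhB : h - h' \is n.-homog by apply: rpredB.
apply: (homog_order_gt_eq0 (edge_subst_homog hhB)).
rewrite !rmorphB /=; set s := loc_poly _ in hf *; set s' := loc_poly _ in hf' *.
have -> : s - s' = (f - s') - (f - s) by ring.
by apply: is_ideal_sub => //; apply: loc_order_ge_ideal.
Qed.

Lemma power_symbol n f : ideal_exp I n f -> exists h, symbol n f h.
Proof.
move: f; apply: gen_power_sub => [|s <- {n}].
  split.
  - by exists 0; apply: symbol0.
  - by move=> x y [h Sh] [h' Sh']; exists (h + h'); apply: symbolD.
  - by move=> a x [h Sh]; exists (residue a *: h); apply: symbolZ.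
elim: s => [|i s [h IH]].
  by exists 1; rewrite big_nil; apply: symbol1.
by exists ('X_i * h); rewrite big_cons /= -add1n; apply: symbolM => //; apply: symbol_edge.
Qed.

(** Orthogonality of [a] to the image of [K] in I/mI, with the edges as coordinates. *)
Definition annihilates (K : set R) (a : 'I_d -> k) :=
  forall c : 'I_d -> R, K (\sum_i c i * e i) -> \sum_i residue (c i) * a i = 0.

(* The linear forms of [K] vanish on the line through [a] and [b], so the
   special fiber ring modulo [K], which vanishes in large degrees, surjects
   onto the coordinate ring of the line modulo the cycle binomial. *)
Lemma reduction_unit (K : set R) (a b c : 'I_d -> k) :
  (4 <= d)%N -> ~~ odd d -> reduction I K -> annihilates K a -> annihilates K b ->
  \sum_i c i * a i = 1 -> \sum_i c i * b i = 0 ->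
  exists q : {poly k}, q * cycle_binomial (fun i => (a i)%:P + (b i)%:P * 'X) = 1.
Proof.
move=> hd hev [KI KsubI [r Er]] Ka Kb ca cb.
pose t i := (a i)%:P + (b i)%:P * 'X.
rewrite -/t.
pose Phi (h : P) := mmap (@polyC k) t h.
have PhiM : {morph Phi : x y / x * y} by move=> x y; rewrite /Phi rmorphM.
have PhiD : {morph Phi : x y / x + y} by move=> x y; rewrite /Phi rmorphD.
have PhiL (v : 'I_d -> k) : Phi (\sum_i v i *: 'X_i) =
    (\sum_i v i * a i)%:P + (\sum_i v i * b i)%:P * 'X.
  rewrite /Phi rmorph_sum /= !rmorph_sum /= mulr_suml -big_split /=.
  apply: eq_bigr => i _; rewrite mmapZ mmapX mmap1U /t !rmorphM /=.
  by rewrite mulrDr mulrA.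
(* [D] collects the elements with some initial form of degree r + 1 that vanishes on the line; it
   contains K I^r, hence I^(r+1). *)
pose D (f : R) := exists2 h, symbol r.+1 f h & Phi h = 0.
have DI : is_ideal D.
  split.
  - by exists 0; [exact: symbol0|rewrite /Phi rmorph0].
  - move=> x y [h S p] [h' S' p']; exists (h + h'); first exact: symbolD.
    by rewrite PhiD p p' addr0.
  - move=> u x [h S p]; exists (residue u *: h); first exact: symbolZ.
    by rewrite /Phi mmapZ -/(Phi h) p mulr0.
have KD : ideal_mul K (ideal_exp I r) `<=` D.
  apply: ideal_mul_sub => // x y Kx Iy.
  have [v Ex] := (gen_finP e x).1 (KsubI _ Kx).
  have [h Sh] := power_symbol Iy.
  exists ((\sum_i residue (v i) *: 'X_i) * h).
    by rewrite -add1n; apply: symbolM => //; rewrite Ex; apply: symbol_linear.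
  by rewrite PhiM PhiL Ka -?Ex // Kb -?Ex // mul0r addr0 mul0r.
(* The linear form of [l] is 1 on the whole line, so [l ^+ r.+1] has one symbol equal to 1 there
   and, by [D], another equal to 0; their difference is a multiple of the binomial. *)
pose l : R := \sum_i loc_const d (c i) * e i.
have Il : I l by apply/gen_finP; exists (fun i => loc_const d (c i)).
have Ilr n : ideal_exp I n (l ^+ n).
  by elim: n => // n IH; rewrite exprS; apply: ideal_mul_mem.
have [h Sh ph] : D (l ^+ r.+1) by apply: KD; rewrite -Er.
have Sl : symbol r.+1 (l ^+ r.+1) ((\sum_i c i *: 'X_i) ^+ r.+1).
  rewrite -[X in symbol X]mul1n; apply: symbolX.
  have := symbol_linear (fun i => loc_const d (c i)).
  by under [X in symbol _ _ X]eq_bigr do rewrite residue_const.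
have [q Eq] := edge_subst_ker (@polyC k) t hd hev (symbol_eq Sl Sh).
exists q; rewrite -Eq -/(Phi _) /Phi rmorphB rmorphXn /= -/(Phi _) -/(Phi h) ph PhiL.
by rewrite ca cb mul0r addr0 expr1n subr0.
Qed.

End Symbols.

(** A matrix of maximal rank with row space inside [V] spans [V]. The columns of [Q] are a basis of
    the column space of its cokernel, and the rows of [S] are dual to them. *)
Lemma subspace_annihilator (k : fieldType) d (V : set 'rV[k]_d) :
  V 0 -> (forall u v, V u -> V v -> V (u + v)) -> (forall c v, V v -> V (c *: v)) ->
  exists r (Q : 'M[k]_(d, r)) (S : 'M[k]_(r, d)),
    S *m Q = 1%:M /\ (forall v, V v <-> v *m Q = 0).
Proof.
move=> V0 VD VZ.
pose good n := `[< exists A : 'M[k]_d, \rank A = n /\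
                     forall v : 'rV_d, (v <= A)%MS -> V v >].
have ex : exists n, good n.
  exists 0%N; apply/asboolP; exists 0; split; first exact: mxrank0.
  by move=> v; rewrite submx0 => /eqP ->.
have ub n : good n -> (n <= d)%N.
  by move=> /asboolP[A [<- _]]; exact: rank_leq_row.
case: (ex_maxnP ex ub) => n /asboolP[A [rA AV]] max.
have VA v : V v -> (v <= A)%MS.
  move=> Vv; have sAB : (A <= A + v)%MS by exact: addsmxSl.
  apply: submx_trans (addsmxSr A v) _.
  rewrite -(geq_leqif (mxrank_leqif_sup sAB)) rA; apply: max.
  apply/asboolP; exists (A + v)%MS; split=> // w /sub_addsmxP[D ->].
  apply: VD; first by apply: AV; exact: submxMl.
  by rewrite [D.2]mx11_scalar mul_scalar_mx; apply: VZ.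
pose C := cokermx A.
have [S SQ] := row_fullP (col_base_full C).
exists (\rank C), (col_base C), S; split=> // v.
have VE : V v <-> v *m C = 0.
  split=> [/VA|/eqP]; first by rewrite submxE => /eqP.
  by rewrite -submxE => /AV.
have CE : v *m C = v *m col_base C *m row_base C by rewrite -mulmxA mulmx_base.
rewrite VE CE; split=> [|->]; last by rewrite mul0mx.
by rewrite -[RHS](mul0mx _ (row_base C)) => /row_free_inj; apply; exact: row_base_free.
Qed.

(** * The hyperplane attached to a reduction *)

Section ReductionPoint.
Variables (k : fieldType) (d : nat) (hd : (4 <= d)%N) (hev : ~~ odd d).
Local Notation R := (loc_ring k d).
Local Notation e := (@cycle_edge k d).
Local Notation I := (cycle_edge_ideal k d).

(* For n = d this is the indicator of the odd indices; for n < d it is the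
   indicator of n together with the indices of the parity opposite to n. *)
Definition test_point (n : nat) (i : 'I_d) : k :=
  ((odd i != odd n) || (i == n :> nat))%:R.

Lemma cycle_binomial_test_point n : cycle_binomial (test_point n) != 0.
Proof.
have p0 : \prod_(i < d | odd i == odd n) test_point n i = 0.
  have [i io ne] := parity_other hd hev (odd n) n.
  by rewrite (bigD1 i) /= ?io // /test_point io eqxx (negbTE ne) mul0r.
have p1 : \prod_(i < d | odd i != odd n) test_point n i = 1.
  by apply: big1 => i ne; rewrite /test_point ne.
rewrite /cycle_binomial; case: (odd n) p0 p1 => p0 p1.
  rewrite (eq_bigl (fun i : 'I_d => odd i == true)); last by move=> i; case: (odd i).
  rewrite p0 (eq_bigl (fun i : 'I_d => odd i != true)); last by move=> i; case: (odd i).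
  by rewrite p1 sub0r oppr_eq0 oner_eq0.
rewrite (eq_bigl (fun i : 'I_d => odd i != false)); last by move=> i; case: (odd i).
rewrite p1 (eq_bigl (fun i : 'I_d => odd i == false)); last by move=> i; case: (odd i).
by rewrite p0 subr0 oner_eq0.
Qed.

Lemma prod_linear_top (T : Type) (s : seq T) (a b : T -> k) :
  (size (\prod_(i <- s) ((a i)%:P + (b i)%:P * 'X))%R <= (size s).+1)%N /\
  (\prod_(i <- s) ((a i)%:P + (b i)%:P * 'X))`_(size s) = \prod_(i <- s) b i.
Proof.
elim: s => [|i s [IHs IHc]]; first by rewrite !big_nil size_poly1 coef1.
rewrite !big_cons; set p := \prod_(j <- s) _ in IHs IHc *.
have E n : (((a i)%:P + (b i)%:P * 'X) * p)`_n.+1 = a i * p`_n.+1 + b i * p`_n.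
  by rewrite mulrDl coefD -mulrA ['X * p]mulrC !coefCM coefMX.
split; last by rewrite E /= IHc nth_default // mulr0 add0r.
apply/leq_sizeP => -[//|n] /= le; rewrite E !nth_default ?mulr0 ?addr0 //.
  exact: leq_trans IHs _.
by apply: leq_trans IHs _; apply: ltnW.
Qed.

(** The parity classes are equinumerous, so both products have the same number of linear factors and
    their top coefficients sit in the same degree. *)
Lemma cycle_binomial_top (a b : 'I_d -> k) :
  (cycle_binomial (fun i => (a i)%:P + (b i)%:P * 'X))`_#|[pred i : 'I_d | odd i]|
  = cycle_binomial b.
Proof.
have top (A : {pred 'I_d}) :
    (\prod_(i in A) ((a i)%:P + (b i)%:P * 'X))`_#|A| = \prod_(i in A) b i.
  by rewrite cardE -!big_enum /= (prod_linear_top _ a b).2.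
rewrite coefB (top [pred i : 'I_d | odd i]) card_odd_even //.
by rewrite (top [pred i : 'I_d | ~~ odd i]).
Qed.

(* Modulo the maximal ideal, a reduction is either all of I or a hyperplane
   whose orthogonal point lies off the cycle binomial hypersurface. *)
Lemma reduction_point (K : set R) : reduction I K ->
  exists2 a : 'I_d -> k, cycle_binomial a != 0 &
    forall v : 'I_d -> k, \sum_i v i * a i = 0 ->
      exists2 c : 'I_d -> R, (forall i, residue (c i) = v i) & K (\sum_i c i * e i).
Proof.
move=> redK; have [[K0 KD KM] _ _] := redK.
pose V (v : 'rV[k]_d) :=
  exists2 c : 'I_d -> R, (forall i, residue (c i) = v 0 i) & K (\sum_i c i * e i).
have [|||r [Q [S [SQ VE]]]] := @subspace_annihilator k d V.
- exists (fun=> 0) => [i|]; first by rewrite rmorph0 mxE.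
  by rewrite big1 // => i _; rewrite mul0r.
- move=> u v [c cu Kc] [c' cv Kc']; exists (fun i => c i + c' i) => [i|].
    by rewrite rmorphD /= cu cv mxE.
  by under eq_bigr do rewrite mulrDl; rewrite big_split; apply: KD.
- move=> x v [c cv Kc]; exists (fun i => loc_const d x * c i) => [i|].
    by rewrite rmorphM /= cv mxE residue_const.
  by under eq_bigr do rewrite -mulrA; rewrite -mulr_sumr; apply: KM.
have ann j : annihilates K (fun i => Q i j).
  move=> c Kc; have /VE /matrixP /(_ 0 j) : V (\row_i residue (c i)).
    by exists c => // i; rewrite mxE.
  by rewrite !mxE => E; rewrite -[RHS]E; apply: eq_bigr => i _; rewrite mxE.
have dual j l : \sum_i S j i * Q i l = (j == l)%:R.
  by have /matrixP /(_ j l) := SQ; rewrite !mxE.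
have nz j : cycle_binomial (fun i => Q i j) != 0.
  (* Direction 0 gives a constant line, on which the unit is the constant G at column [j] of [Q]. *)
  have ann0 : annihilates K (fun=> 0).
    by move=> c _; rewrite big1 // => i _; rewrite mulr0.
  have := reduction_unit (c := fun i => S j i) hd hev redK (ann j) ann0.
  rewrite dual eqxx => /(_ erefl) [|q Eq].
    by rewrite big1 // => i _; rewrite mulr0.
  apply/eqP => g0; move: Eq; rewrite (_ : cycle_binomial _ = 0) ?mulr0.
    by move/eqP; rewrite eq_sym oner_eq0.
  transitivity (cycle_binomial (fun i => Q i j))%:P; last by rewrite g0.
  rewrite rmorphB /= !rmorph_prod /=.
  by congr (_ - _); apply: eq_bigr => i _; rewrite mul0r addr0.
(* With no equation any point off the hypersurface works; with one equation its column is the point.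
   Two equations would give a line on which G is a unit of k[X], hence constant, although its top
   coefficient is G at the second column, which is nonzero. *)
case: r => [|[|r]] in Q S SQ VE ann dual nz *.
- exists (test_point d); first exact: cycle_binomial_test_point.
  move=> v _; have [c cv Kc] : V (\row_i v i) by apply/VE; exact: thinmx0.
  by exists c => // i; rewrite cv mxE.
- exists (fun i => Q i 0) => // v vQ.
  have [c cv Kc] : V (\row_i v i).
    apply/VE/matrixP => i j; rewrite !ord1 !mxE -[RHS]vQ.
    by apply: eq_bigr => l _; rewrite mxE.
  by exists c => // i; rewrite cv mxE.
- pose j0 : 'I_r.+2 := ord0; pose j1 : 'I_r.+2 := lift ord0 ord0.
  have := reduction_unit (c := fun i => S j0 i) hd hev redK (ann j0) (ann j1).
  rewrite !dual eqxx => /(_ erefl erefl)[q Eq].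
  have := nz j1; rewrite -(cycle_binomial_top (fun i => Q i j0)) nth_default ?eqxx //.
  set g := cycle_binomial _ in Eq *.
  have : g %| 1 by apply/dvdpP; exists q; rewrite Eq.
  rewrite dvdp1 => /eqP ->.
  have lt1 : (1 < d)%N by exact: leq_trans hd.
  by apply/card_gt0P; exists (Ordinal lt1).
Qed.

End ReductionPoint.

(** * The cyclic linear system *)

Section CyclicChain.
Variables (d : nat) (hd : (4 <= d)%N) (hev : ~~ odd d).

Lemma val_iter_ordS n (l : 'I_d) : iter n (@ordS d) l = ((l + n) %% d)%N :> nat.
Proof.
elim: n => [|n IH]; first by rewrite addn0 modn_small.
by rewrite iterS /= IH -addn1 modnDml addn1 addnS.
Qed.

Lemma card_parity (l : 'I_d) : #|[set i : 'I_d | odd i == odd l]%SET| = d./2.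
Proof.
have tot : (#|[pred i : 'I_d | odd i]| + #|[pred i : 'I_d | ~~ odd i]| = d)%N.
  by rewrite -[RHS]card_ord -(cardC [pred i : 'I_d | odd i]).
have oe := card_odd_even hev.
rewrite cardsE; transitivity #|[pred i : 'I_d | odd i]|; last first.
  by rewrite -[in RHS]tot -oe addnn doubleK.
by case: (odd l); [|rewrite oe]; apply: eq_card => i; rewrite [LHS]unfold_in !inE; case: (odd i).
Qed.

(** The d/2 steps of length two starting at [l] are distinct and keep the parity of [l], so by
    counting they exhaust its class. *)
Lemma prod_iter_ordS (A : comNzRingType) (F : 'I_d -> A) (l : 'I_d) :
  \prod_(s < d./2) F (iter s.*2 (@ordS d) l) = \prod_(i < d | odd i == odd l) F i.
Proof.
have E : (d./2).*2 = d by have := odd_double_half d; rewrite (negbTE hev).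
pose h (s : 'I_d./2) := iter s.*2 (@ordS d) l.
have hinj : injective h.
  move=> s s' /(congr1 (@nat_of_ord d)) /eqP; rewrite /h !val_iter_ordS eqn_modDl.
  rewrite !modn_small; last 2 first.
  - by rewrite -[X in (_ < X)%N]E ltn_double.
  - by rewrite -[X in (_ < X)%N]E ltn_double.
  by move/eqP => ss'; apply: val_inj; rewrite /= -[LHS]doubleK ss' doubleK.
transitivity (\prod_(i in [set h s | s : 'I_d./2]%SET) F i).
  by rewrite big_imset //= => x y _ _; apply: hinj.
apply: eq_bigl => i; suff -> : [set h s | s : 'I_d./2]%SET = [set i : 'I_d | odd i == odd l]%SET.
  by rewrite inE.
apply/eqP; rewrite eqEcard card_parity card_imset // card_ord leqnn andbT.
apply/fintype.subsetP => _ /imsetP[s _ ->]; rewrite inE /h.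
by elim: (nat_of_ord s) => // n /eqP IH; rewrite doubleS !iterS !odd_ordS // negbK IH.
Qed.

(** Chaining the relations along the parity class of [l] returns to [z l] after d/2 steps, with the
    product of that class on one side and of the other class on the other. Their difference is G up
    to sign. *)
Lemma cyclic_chain (A : comNzRingType) (L : set A) (al z : 'I_d -> A) : is_ideal L ->
  (forall i, L (al i * z (ordS (ordS i)) - al (ordS i) * z i)) ->
  forall l, L (cycle_binomial al * z l).
Proof.
move=> [L0 LD LM] H l.
have LN x : L x -> L (- x) by rewrite -mulN1r; apply: LM.
pose it s := iter s.*2 (@ordS d) l.
have chain n : L ((\prod_(s < n) al (it s)) * z (it n)
                  - (\prod_(s < n) al (ordS (it s))) * z l).
  elim: n => [|n IH]; first by rewrite !big_ord0 !mul1r subrr.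
  rewrite !big_ord_recr /=.
  set p := \prod_(s < n) al (it s) in IH *; set p' := \prod_(s < n) _ in IH *.
  rewrite -/(it n).
  have -> : p * al (it n) * z (ordS (ordS (it n))) - p' * al (ordS (it n)) * z l =
    p * (al (it n) * z (ordS (ordS (it n))) - al (ordS (it n)) * z (it n))
    + al (ordS (it n)) * (p * z (it n) - p' * z l) by ring.
  by apply: LD; apply: LM.
have itl : it d./2 = l.
  apply: val_inj; rewrite [LHS]val_iter_ordS.
  have -> : (d./2).*2 = d by have := odd_double_half d; rewrite (negbTE hev).
  by rewrite modnDr modn_small.
have := chain d./2; rewrite itl prod_iter_ordS (prod_iter_ordS (al \o @ordS d)).
have -> : \prod_(i < d | odd i == odd l) (al \o @ordS d) i = \prod_(i < d | odd i != odd l) al i.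
  rewrite [RHS](reindex_inj (@ordS_inj d)); apply: eq_bigl => i.
  by rewrite odd_ordS //; case: (odd i); case: (odd l).
rewrite -mulrBl /cycle_binomial; case: (odd l).
  rewrite (eq_bigl (fun i : 'I_d => odd i)); last by move=> i; case: (odd i).
  by rewrite [X in _ - X](eq_bigl (fun i : 'I_d => ~~ odd i)); last by move=> i; case: (odd i).
rewrite (eq_bigl (fun i : 'I_d => ~~ odd i)); last by move=> i; case: (odd i).
rewrite [X in _ - X](eq_bigl (fun i : 'I_d => odd i)); last by move=> i; case: (odd i).
by move=> /LN; rewrite -mulNr opprB.
Qed.

End CyclicChain.

(** * Inclusion of mI in an ideal covering a hyperplane *)

Section MaximalIdeal.
Variables (k : fieldType) (d : nat) (hd : (4 <= d)%N) (hev : ~~ odd d).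
Local Notation R := (loc_ring k d).
Local Notation e := (@cycle_edge k d).
Local Notation I := (cycle_edge_ideal k d).

Lemma cycle_binomial_morph (A B : comNzRingType) (f : {rmorphism A -> B}) (t : 'I_d -> A) :
  f (cycle_binomial t) = cycle_binomial (f \o t).
Proof. by rewrite rmorphB !rmorph_prod. Qed.

Lemma cycle_binomial_neq0 (a : 'I_d -> k) :
  cycle_binomial a != 0 -> exists j, a j != 0.
Proof.
move=> G; apply/existsP; apply: contraNT G; rewrite negb_exists => /forallP a0.
have {}a0 i : a i = 0 by apply/eqP; have := a0 i; rewrite negbK.
have lt1 : (1 < d)%N by exact: leq_trans hd.
have lt0 : (0 < d)%N by exact: leq_trans hd.
rewrite /cycle_binomial (bigD1 (Ordinal lt1)) //= a0 mul0r.
by rewrite (bigD1 (Ordinal lt0)) //= a0 mul0r subrr.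
Qed.

Lemma max_mul_edge_sub (K : set R) (a : 'I_d -> k) :
  is_ideal K -> cycle_binomial a != 0 ->
  (forall v : 'I_d -> k, \sum_i v i * a i = 0 ->
     exists2 c : 'I_d -> R, (forall i, residue (c i) = v i) & K (\sum_i c i * e i)) ->
  forall c : 'I_d -> R, (forall i, residue (c i) = 0) -> K (\sum_i c i * e i).
Proof.
move=> KI Ga KV; have [K0 KD KM] := KI.
pose x (l : 'I_d) : R := loc_poly 'X_l.
pose y (t : 'I_d * 'I_d) : R := x t.1 * e t.2.
suff Ky t : K (y t).
  move=> c c0; apply: is_ideal_sum => // i _.
  (* Clearing the unit denominator leaves a numerator in (x_1, .., x_d), so the generators x_l e_i
     of mI suffice. *)
  have [p [s [s0 E]]] := loc_fracP (c i).
  have := residueE s0 E; rewrite c0 => /esym /eqP; rewrite mulf_eq0 invr_eq0 (negbTE s0) orbF.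
  move=> /eqP p0; apply: (@is_ideal_cancel _ _ _ KI (loc_poly s)).
    by rewrite residue_poly.
  rewrite mulrA (_ : loc_poly s * c i = loc_poly p); last first.
    apply: val_inj; rewrite rmorphM /= -[loc_val _]/(val (c i)) E mulrC divfK //.
    exact: const_neq0_frac.
  suff /(_ p p0) : forall q, q@_0%MM = 0 -> K (loc_poly q * e i) by [].
  move=> q /var_idealE; apply: (ideal_gen_min (J := [set q | K (loc_poly q * e i)])).
    split=> [|f g Kf Kg|f g Kg] /=; first by rewrite rmorph0 mul0r.
      by rewrite rmorphD mulrDl; apply: KD.
    by rewrite rmorphM -mulrA; apply: KM.
  by move=> _ [l _ <-]; apply: (Ky (l, i)).
move: t; apply: nakayama => //.
(* [K'] is K + m^2 I, modulo which Nakayama requires every x_l e_i to vanish. *)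
pose K' (f : R) := exists2 c : 'I_d * 'I_d -> R,
  (forall t, residue (c t) = 0) & K (f - \sum_t c t * y t).
suff : forall t, K' (y t) by [].
have K'I : is_ideal K'.
  split.
  - exists (fun=> 0) => [t|]; first by rewrite rmorph0.
    by rewrite big1 ?subr0 // => t _; rewrite mul0r.
  - move=> f g [c c0 Kc] [c' c'0 Kc']; exists (fun t => c t + c' t) => [t|].
      by rewrite rmorphD /= c0 c'0 addr0.
    under eq_bigr do rewrite mulrDl.
    by rewrite big_split /= opprD addrACA; apply: KD.
  - move=> u f [c c0 Kc]; exists (fun t => u * c t) => [t|].
      by rewrite rmorphM /= c0 mulr0.
    under eq_bigr do rewrite -mulrA.
    by rewrite -mulr_sumr -mulrBr; apply: KM.
have KK' f : K f -> K' f.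
  move=> Kf; exists (fun=> 0) => [t|]; first by rewrite rmorph0.
  by rewrite big1 ?subr0 // => t _; rewrite mul0r.
have my w t : residue w = 0 -> K' (w * y t).
  move=> w0; exists (fun t' => w * (t' == t)%:R) => [t'|].
    by rewrite rmorphM /= w0 mul0r.
  rewrite (bigD1 t) //= eqxx mulr1 big1 ?addr0 ?subrr // => t' /negbTE ->.
  by rewrite mulr0 mul0r.
have [j aj] := cycle_binomial_neq0 Ga.
pose al i := loc_const d (a i).
have [_ K'D K'M] := K'I.
(* The coefficient vector is orthogonal to [a], so some lift of it lies in [K]; the error of the
   lift has coefficients in m and, multiplied by x_l, falls into m^2 I. *)
have rel l i : K' (x l * (al j * e i - al i * e j)).
  pose v (i' : 'I_d) := a j * (i' == i)%:R - a i * (i' == j)%:R.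
  have vsum (B : comNzRingType) (f : {rmorphism k -> B}) (w : 'I_d -> B) :
      \sum_i' f (v i') * w i' = f (a j) * w i - f (a i) * w j.
    under eq_bigr do rewrite rmorphB !rmorphM /= !rmorph_nat mulrBl.
    rewrite sumrB (bigD1 i) //= eqxx mulr1 big1 ?addr0; last first.
      by move=> i' /negbTE ->; rewrite mulr0 mul0r.
    rewrite (bigD1 j) //= eqxx mulr1 big1 ?addr0 //.
    by move=> i' /negbTE ->; rewrite mulr0 mul0r.
  have [|c cv Kc] := KV v.
    by rewrite (vsum _ idfun) /= mulrC subrr.
  have -> : x l * (al j * e i - al i * e j) =
      x l * (\sum_i c i * e i) + \sum_i (loc_const d (v i) - c i) * y (l, i).
    rewrite -(vsum _ (@loc_const k d)) !mulr_sumr -big_split /=.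
    by apply: eq_bigr => i' _; rewrite /y /=; ring.
  apply: K'D; first by apply: K'M; apply: KK'.
  apply: is_ideal_sum => // i' _; apply: my.
  by rewrite rmorphB /= residue_const cv subrr.
have ze l : K' (x l * e j).
  apply: (@is_ideal_cancel _ _ _ K'I (cycle_binomial al)).
    rewrite cycle_binomial_morph (_ : _ \o _ = a) //.
    by apply/funext => i /=; rewrite residue_const.
  apply: (@cyclic_chain _ hev _ K' al (fun l => x l * e j)) => // i.
  (* The linear syzygy of consecutive edges; replacing both edges by multiples of [e j] turns it
     into the cyclic system. *)
  have E : x (ordS (ordS i)) * e i = x i * e (ordS i).
    rewrite /x /cycle_edge -!rmorphM; congr loc_poly; ring.
  have -> : al i * (x (ordS (ordS i)) * e j) - al (ordS i) * (x i * e j) =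
    x i * (al j * e (ordS i) - al (ordS i) * e j)
    - x (ordS (ordS i)) * (al j * e i - al i * e j).
    rewrite !mulrBr ![x _ * (al j * _)]mulrCA E; ring.
  by apply: is_ideal_sub.
move=> [l i]; apply: (@is_ideal_cancel _ _ _ K'I (al j)); first by rewrite residue_const.
have -> : al j * y (l, i) = x l * (al j * e i - al i * e j) + al i * (x l * e j).
  by rewrite /y /=; ring.
by apply: K'D => //; apply: K'M.
Qed.

End MaximalIdeal.

(** * Hyperplane ideals as minimal reductions *)

Section HyperplaneReductions.
Variables (k : fieldType) (d : nat) (hd : (4 <= d)%N) (hev : ~~ odd d).
Local Notation P := {mpoly k[d]}.
Local Notation R := (loc_ring k d).
Local Notation e := (@cycle_edge k d).
Local Notation I := (cycle_edge_ideal k d).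

(* The coordinate points lie on the cycle binomial hypersurface. *)
Lemma edge_coord_residue (c c' : 'I_d -> R) :
  \sum_i c i * e i = \sum_i c' i * e i -> forall i, residue (c i) = residue (c' i).
Proof.
move=> E i; have S := symbol_linear c; rewrite E in S.
pose t (i' : 'I_d) : k := (i' == i)%:R.
have t0 b : \prod_(i' < d | odd i' == b) t i' = 0.
  have [i' i'b ne] := parity_other hd hev b i.
  by rewrite (bigD1 i') ?i'b //= /t -val_eqE (negbTE ne) mul0r.
have G0 : cycle_binomial t = 0.
  have := t0 true; have := t0 false; rewrite /cycle_binomial.
  under eq_bigl do rewrite eqbF_neg; under [X in _ -> X = _ -> _]eq_bigl do rewrite eqb_id.
  by move=> -> ->; rewrite subrr.
have [q] := edge_subst_ker idfun t hd hev (symbol_eq S (symbol_linear c')).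
have val (u : 'I_d -> R) : mmap idfun t (\sum_i residue (u i) *: 'X_i : P) = residue (u i).
  rewrite rmorph_sum /= (bigD1 i) //= mmapZ mmapX mmap1U /t eqxx mulr1.
  by rewrite big1 ?addr0 // => i' /negbTE ni; rewrite mmapZ mmapX mmap1U ni mulr0.
by rewrite rmorphB /= !val G0 mulr0 => /eqP; rewrite subr_eq0 => /eqP.
Qed.

(** The edges of one parity form a perfect matching, so each product is the product of all the
    variables. *)
Lemma prod_cycle_edge : \prod_(i < d | odd i) e i = \prod_(i < d | ~~ odd i) e i.
Proof.
have E (b : bool) : \prod_(i < d | odd i == b) e i = loc_poly (\prod_(i < d) 'X_i).
  rewrite -rmorph_prod; congr loc_poly.
  rewrite big_split /= [RHS](bigID (fun i : 'I_d => odd i == b)) /=; congr (_ * _).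
  rewrite [RHS](reindex_inj (@ordS_inj d)); apply: eq_bigl => i.
  by rewrite odd_ordS //; case: (odd i); case: b.
have := E true; rewrite -(E false).
by under eq_bigl do rewrite eqb_id; under [X in _ = X -> _]eq_bigl do rewrite eqbF_neg.
Qed.

(** This is a^perp + mI: only residues are constrained, so coefficients in m are free. *)
Definition hyperplane_ideal (a : 'I_d -> k) : set R :=
  [set f | exists2 c : 'I_d -> R, f = \sum_i c i * e i & \sum_i residue (c i) * a i = 0].

Lemma hyperplane_ideal_ideal a : is_ideal (hyperplane_ideal a).
Proof.
split.
- exists (fun=> 0); rewrite big1 // => i _; first by rewrite mul0r.
  by rewrite rmorph0 mul0r.
- move=> _ _ [c -> ca] [c' -> c'a]; exists (fun i => c i + c' i).
    by rewrite -big_split; apply: eq_bigr => i _; rewrite mulrDl.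
  under eq_bigr do rewrite rmorphD mulrDl.
  by rewrite big_split /= ca c'a addr0.
- move=> u _ [c -> ca]; exists (fun i => u * c i).
    by rewrite mulr_sumr; apply: eq_bigr => i _; rewrite mulrA.
  under eq_bigr do rewrite rmorphM -mulrA.
  by rewrite -mulr_sumr ca mulr0.
Qed.

Lemma hyperplane_ideal_sub a : hyperplane_ideal a `<=` I.
Proof. by move=> f [c -> _]; apply/gen_finP; exists c. Qed.

(* Modulo the hyperplane ideal, every monomial of degree n in the edges is a
   multiple of [e j ^+ n]; equating the odd and the even product kills
   [e j ^+ d./2]. *)
Lemma hyperplane_reduction a : cycle_binomial a != 0 -> reduction I (hyperplane_ideal a).
Proof.
move=> Ga; set J := hyperplane_ideal a.
have JI : is_ideal J := hyperplane_ideal_ideal a.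
split=> //; first exact: hyperplane_ideal_sub.
have [j aj] := cycle_binomial_neq0 hd Ga.
pose al i := loc_const d (a i / a j).
have Jrel i : J (e i - al i * e j).
  pose c (i' : 'I_d) : R := (i' == i)%:R - al i * (i' == j)%:R.
  have csum (B : comNzRingType) (f : {rmorphism R -> B}) (w : 'I_d -> B) :
      \sum_i' f (c i') * w i' = w i - f (al i) * w j.
    under eq_bigr do rewrite rmorphB rmorphM /= !rmorph_nat mulrBl.
    rewrite sumrB (bigD1 i) //= eqxx mul1r big1 ?addr0; last first.
      by move=> i' /negbTE ->; rewrite mul0r.
    rewrite (bigD1 j) //= eqxx mulr1 big1 ?addr0 //.
    by move=> i' /negbTE ->; rewrite mulr0 mul0r.
  exists c; first by rewrite (csum _ idfun).
  by rewrite csum /= residue_const divfK // subrr.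
pose L n := ideal_mul J (ideal_exp I n).
have LI n : is_ideal (L n) by exact: ideal_mul_ideal.
have step n i : L n `<=` [set f | L n.+1 (e i * f)].
  have [L0 LD LM] := LI n.+1.
  apply: ideal_mul_sub => [|x y Jx Iy] /=.
    split=> [|f g Lf Lg|f g Lg] /=; first by rewrite mulr0.
      by rewrite mulrDr; apply: LD.
    by rewrite mulrCA; apply: LM.
  rewrite mulrCA; apply: ideal_mul_mem => //; apply: ideal_mul_mem => //.
  exact: gen_mem.
have red n (s : seq 'I_d) : size s = n.+1 ->
    L n (\prod_(i <- s) e i - (\prod_(i <- s) al i) * e j ^+ n.+1).
  elim: n s => [|n IH] [//|i s] /= [sn].
    move/size0nil: sn => ->; rewrite !big_seq1 expr1 -[X in L _ X]mulr1.
    exact: ideal_mul_mem.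
  rewrite !big_cons exprS.
  set p := \prod_(i <- s) e i; set b := \prod_(i <- s) al i.
  have -> : e i * p - al i * b * (e j * e j ^+ n.+1) =
    (e i - al i * e j) * p + al i * (e j * (p - b * e j ^+ n.+1)) by ring.
  have [_ LD LM] := LI n.+1; apply: LD.
    by apply: ideal_mul_mem => //; rewrite -sn; apply: gen_power_mem.
  by apply: LM; apply: step; apply: IH.
have lt1 : (1 < d)%N by exact: leq_trans hd.
(* [r.+1] is the common size d/2 of the parity classes, the degree of G. *)
pose r := #|[pred i : 'I_d | odd i]|.-1.
have ro : #|[pred i : 'I_d | odd i]| = r.+1.
  by rewrite prednK //; apply/card_gt0P; exists (Ordinal lt1).
have re : #|[pred i : 'I_d | ~~ odd i]| = r.+1 by rewrite -card_odd_even.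
have eo := red r (enum [pred i : 'I_d | odd i]).
have ee := red r (enum [pred i : 'I_d | ~~ odd i]).
rewrite -cardE in eo; rewrite -cardE in ee.
have := is_ideal_sub (LI r) (eo ro) (ee re); rewrite !big_enum /= prod_cycle_edge.
rewrite opprB addrC addrA subrK => /(is_ideal_opp (LI r)); rewrite opprB -mulrBl.
rewrite -[_ - _]/(cycle_binomial al) => /(is_ideal_cancel (LI r)) Lj.
exists r; apply/seteqP; split; last first.
  apply: ideal_mul_sub; first exact: ideal_mul_ideal.
  by move=> x y Jx Iy; apply: ideal_mul_mem => //; apply: hyperplane_ideal_sub Jx.
apply: (@gen_power_sub _ _ e r.+1 (L r) (LI r)) => s sr.
(* By homogeneity the residue of [cycle_binomial al] is G(a) / a_j^(r+1), so this factor is a unit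
   and cancels. *)
have {}Lj : L r (e j ^+ r.+1).
  apply: Lj; rewrite cycle_binomial_morph.
  have -> : @residue k d \o al = fun i => a i * (a j)^-1.
    by apply/funext => i /=; rewrite residue_const.
  rewrite /cycle_binomial !big_split /= !prodr_const ro re -mulrBl mulf_neq0 //.
  by rewrite expf_neq0 // invr_eq0.
have [_ LD LM] := LI r.
by rewrite -[X in L _ X](subrK ((\prod_(i <- s) al i) * e j ^+ r.+1)); apply: LD; [exact: red|exact: LM].
Qed.

Lemma max_mul_edge_sub_reduction (K : set R) : reduction I K ->
  forall c : 'I_d -> R, (forall i, residue (c i) = 0) -> K (\sum_i c i * e i).
Proof.
move=> redK; have [a Ga KV] := reduction_point hd hev redK.
by have [KI _ _] := redK; apply: max_mul_edge_sub KV.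
Qed.

(** A smaller reduction [K] has its own point [b] with b^perp inside a^perp, so [a] and [b] are
    proportional. Then [K] contains a lift of each vector of a^perp, and also mI. *)
Lemma hyperplane_minimal_reduction a :
  cycle_binomial a != 0 -> minimal_reduction I (hyperplane_ideal a).
Proof.
move=> Ga; split; first exact: hyperplane_reduction.
move=> K redK KJ; apply/seteqP; split=> // f [c -> ca].
have [[_ KD _] _ _] := redK.
have [b Gb KV] := reduction_point hd hev redK.
have ba v : \sum_i v i * b i = 0 -> \sum_i v i * a i = 0.
  move=> /KV[u uv /KJ[u' E ua]]; rewrite -[RHS]ua; apply: eq_bigr => i _.
  by rewrite -uv (edge_coord_residue E).
have [j bj] := cycle_binomial_neq0 hd Gb.
have prop i : b j * a i = b i * a j.
  pose v (i' : 'I_d) := b j * (i' == i)%:R - b i * (i' == j)%:R.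
  have vsum (w : 'I_d -> k) : \sum_i' v i' * w i' = b j * w i - b i * w j.
    under eq_bigr do rewrite mulrBl.
    rewrite sumrB (bigD1 i) //= eqxx mulr1 big1 ?addr0; last first.
      by move=> i' /negbTE ->; rewrite mulr0 mul0r.
    rewrite (bigD1 j) //= eqxx mulr1 big1 ?addr0 //.
    by move=> i' /negbTE ->; rewrite mulr0 mul0r.
  apply/eqP; rewrite -subr_eq0 -vsum; apply/eqP/ba.
  by rewrite vsum mulrC subrr.
have aj : a j != 0.
  have [l al] := cycle_binomial_neq0 hd Ga.
  apply/eqP => aj0; have := prop l; rewrite aj0 mulr0 => /eqP.
  by rewrite mulf_eq0 (negbTE bj) (negbTE al).
have [|u uc Ku] := KV (fun i => residue (c i)).
  apply: (mulIf aj); rewrite mul0r mulr_suml.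
  under eq_bigr do rewrite -mulrA -prop mulrCA.
  by rewrite -mulr_sumr ca mulr0.
rewrite -[X in K X](subrK (\sum_i u i * e i)); apply: KD => //.
rewrite -sumrB; under eq_bigr do rewrite -mulrBl.
by apply: max_mul_edge_sub_reduction => // i; rewrite rmorphB /= uc subrr.
Qed.

(** The point for [n = d] kills the sum of the odd coordinates, so each even [n] isolates [v n];
    with the even coordinates zero, each odd [n] does too. *)
Lemma test_points_span (v : 'I_d -> k) :
  (forall n : 'I_d.+1, \sum_i v i * test_point k n i = 0) -> forall i, v i = 0.
Proof.
move=> H.
have split_point (n : 'I_d) :
    \sum_i v i * test_point k n i = \sum_(i < d | odd i != odd n) v i + v n.
  rewrite (bigD1 n) //= {1}/test_point !eqxx mulr1 addrC; congr (_ + _).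
  rewrite [LHS]big_mkcond [RHS]big_mkcond; apply: eq_bigr => i _.
  have [->|ne] := eqVneq i n; first by rewrite eqxx.
  by rewrite /test_point [_ == _ :> nat](negbTE ne) orbF; case: (_ != _); rewrite ?mulr1 ?mulr0.
have sodd : \sum_(i < d | odd i) v i = 0.
  rewrite -[RHS](H ord_max) big_mkcond; apply: eq_bigr => i _.
  rewrite /test_point /= (negbTE hev) (ltn_eqF (ltn_ord i)) orbF.
  by case: (odd i); rewrite ?mulr1 ?mulr0.
have veven (n : 'I_d) : ~~ odd n -> v n = 0.
  move=> /negbTE no; have := H (widen_ord (leqnSn d) n); rewrite split_point /= no.
  rewrite (eq_bigl (fun i : 'I_d => odd i)) ?sodd ?add0r //.
  by move=> i; case: (odd i).
move=> n; case: (boolP (odd n)) => [no|]; last exact: veven.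
have := H (widen_ord (leqnSn d) n); rewrite split_point /= no big1 ?add0r //.
by move=> i io; apply: veven; case: (odd i) io.
Qed.

End HyperplaneReductions.

(** * The core as an intersection over the test points *)

Theorem theorem5p6 (k : fieldType) (hk : infinite_set [set: k])
    (d : nat) (hd : (4 <= d)%N) (hev : ~~ odd d) :
  exists (m : nat) (J : 'I_m.+1 -> set (loc_ring k d)),
    (forall i, minimal_reduction (cycle_edge_ideal k d) (J i)) /\
    core (cycle_edge_ideal k d) = \bigcap_(i in [set: 'I_m.+1]) J i.
Proof.
exists d, (fun n => hyperplane_ideal (test_point k n)).
have G n := cycle_binomial_test_point k hd hev n.
split=> [n|]; first exact: hyperplane_minimal_reduction.
apply/seteqP; split=> [f cf n _|f Jf K redK]; first by apply: cf; apply: hyperplane_reduction.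
(* The residues of [c] do not depend on the chosen expression of [f], so they are orthogonal to all
   d + 1 test points and vanish: [f] lies in mI, hence in [K]. *)
have [c Ef _] := Jf ord0 Logic.I; rewrite Ef.
apply: max_mul_edge_sub_reduction => //.
apply: test_points_span => // n; have [c' Ef' c'n] := Jf n Logic.I.
rewrite -[RHS]c'n; apply: eq_bigr => i _.
by rewrite (@edge_coord_residue _ _ hd hev c c') -?Ef -?Ef'.
Qed.
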